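(* For every $n\ge 1$, the book graph $B_n$ is $Q$-unique: if $H$ is a finite simple graph with $Q(H;x,y)=Q(B_n;x,y)$, then $H\cong B_n$.
   Context: For a finite simple graph $G=(V,E)$, the subgraph component polynomial is $Q(G;x,y)=\sum_{X\subseteq V} x^{|X|}y^{k(G[X])}$, where $G[X]$ is the induced subgraph on $X$ and $k(\cdot)$ denotes the number of connected components. The $n$-book graph $B_n$ is obtained by taking $n$ copies of the 4-cycle $C_4$ that all share one common edge $\{u,v\}$ (and are otherwise disjoint); i.e. its vertices are $u,v,x_1,y_1,\dots,x_n,y_n$ and its edges are $uv$ and $ux_i,x_iy_i,y_iv$ for $i=1,\dots,n$. It has $2n+2$ vertices and $3n+1$ edges. *)

(* Defs.v *)
From HB Require Import structures.
From mathcomp Require Import all_boot all_algebra.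

Set Implicit Arguments.
Unset Strict Implicit.
Unset Printing Implicit Defensive.

Import GRing.Theory.
Local Open Scope ring_scope.

Record sgraph := SGraph {
  vertex :> finType;
  edge : rel vertex;
  edge_sym : symmetric edge;
  edge_irrefl : irreflexive edge
}.
Arguments edge {G} x y : rename.

Definition isomorphic (G H : sgraph) : Prop :=
  exists f : G -> H,
    bijective f /\ forall x y : G, edge (f x) (f y) = edge x y.

Section Induced.
Variables (G : sgraph) (X : {set G}).

Definition induced_edge : rel {x : G | x \in X} :=
  fun x y => edge (val x) (val y).

Lemma induced_edge_sym : symmetric induced_edge.
Proof. by move=> x y; apply: edge_sym. Qed.

Lemma induced_edge_irrefl : irreflexive induced_edge.
Proof. by move=> x; apply: edge_irrefl. Qed.

Definition induced : sgraph := SGraph induced_edge_sym induced_edge_irrefl.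

End Induced.

Definition components (G : sgraph) : nat := n_comp (@edge G) G.

(* Bivariate polynomials follow the polyXY convention: 'X is the outer
   variable and 'Y = 'X%:P the inner one. *)
Definition Q (G : sgraph) : {poly {poly int}} :=
  \sum_(X : {set G}) 'X ^+ #|X| * 'Y ^+ components (induced X).

Definition Q_unique (G : sgraph) : Prop :=
  forall H : sgraph, Q H = Q G -> isomorphic H G.

Section Book.
Variable n : nat.

(* Encoding of the vertices: u = inl false, v = inl true,
   x_i = inr (i, false), y_i = inr (i, true). *)
Definition book_vertex : finType := (bool + 'I_n * bool)%type.

Definition book_edge : rel book_vertex := fun p q =>
  match p, q with
  | inl a, inl b => a != b                                   (* u v *)
  | inl a, inr (_, b) | inr (_, b), inl a => a == b          (* u x_i, v y_i *)
  | inr (i, a), inr (j, b) => (i == j) && (a != b)           (* x_i y_i *)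
  end.

Lemma book_edge_sym : symmetric book_edge.
Proof.
move=> [a|[i a]] [b|[j b]] //=; first by rewrite eq_sym.
by rewrite eq_sym [a == b]eq_sym.
Qed.

Lemma book_edge_irrefl : irreflexive book_edge.
Proof. by move=> [a|[i a]] /=; rewrite !eqxx. Qed.

Definition book : sgraph := SGraph book_edge_sym book_edge_irrefl.

End Book.

(* Main.v *)
(** The polynomial Q records the multiset of pairs (|X|, k(G[X])).  The vertex
    sets with at most three elements give the number of edges, of triangles and
    the sum of the squared degrees; the sets missing one vertex show that H has
    no cut vertex; the set missing the spine of the book gives vertices a, b of H
    whose deletion leaves n components on 2n vertices.  Each of these components
    contains a neighbour of a and a neighbour of b.
    If a and b are adjacent, their neighbourhoods are disjoint as H is
    triangle-free, so every component consists of exactly one neighbour of a and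
    one of b, and H is the book.
    If they are not, then deg a + deg b <= 2n + 1 because a graph has at least
    |V| - |E| components, and comparing the sums of squared degrees forces n = 2.
    In that case two vertices p, q have degree at least 3; deleting a pair from
    the book B_2 leaves at most two components, so the same bound on the number
    of components makes p and q adjacent with H - {p, q} having two components. *)

Require Import Defs.
From mathcomp Require Import all_boot all_algebra zify.

Set Implicit Arguments.
Unset Strict Implicit.
Unset Printing Implicit Defensive.

(** * Components of induced subgraphs *)

Section Restriction.
Variable G : sgraph.
Implicit Types (X S : {set G}) (x y z : G).

(** Living on all of [G], with vertices outside [X] isolated, this relation avoids the sigma type of
    [induced X] as [X] varies. *)
Definition restr X : rel G := fun x y => [&& x \in X, y \in X & edge x y].

Definition comps X : nat := components (induced X).

Definition deg x : nat := \sum_y edge x y.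

(** Twice the number of edges of [G[X]]. *)
Definition arcs X : nat := \sum_(x in X) \sum_(y in X) edge x y.

Lemma restr_sym X : symmetric (restr X).
Proof. by move=> x y; rewrite /restr edge_sym andbCA. Qed.

Lemma restr_connect_sym X : connect_sym (restr X).
Proof. exact: sym_connect_sym (restr_sym X). Qed.

Lemma restr_closed X : closed (restr X) X.
Proof. by move=> x y /and3P[-> ->]. Qed.

Lemma connect_restr_in X x y : connect (restr X) x y -> x \in X -> y \in X.
Proof. by move/(closed_connect (@restr_closed X)) => ->. Qed.

Lemma root_in X x : x \in X -> fingraph.root (restr X) x \in X.
Proof. by apply: connect_restr_in; apply: connect_root. Qed.

Lemma connect_restr_step X x y : connect (restr X) x y -> x != y ->
  exists2 z, restr X x z & connect (restr X) x z.
Proof.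
case/connectP => [[|z p] /= ]; first by move=> _ ->; rewrite eqxx.
by case/andP=> xz _ _ _; exists z => //; apply: connect1.
Qed.

Lemma comps_n_comp X : comps X = n_comp (restr X) X.
Proof.
have symI : connect_sym (@edge (induced X)).
  by apply: sym_connect_sym; apply: edge_sym.
rewrite (adjunction_n_comp (val : induced X -> G) (restr_connect_sym X) symI
           (@restr_closed X)).
  by apply: eq_n_comp_r => x; rewrite !inE; apply/esym/(valP x).
apply: strict_adjunction => [||||u v _] /=.
- exact: symI.
- exact: restr_closed.
- exact: val_inj.
- by apply/subsetP => x xX; apply/codomP; exists (Sub x xX).
- by rewrite /restr (valP u) (valP v).
Qed.

Lemma comps_roots X : comps X = #|[set fingraph.root (restr X) x | x in X]|.
Proof.
rewrite comps_n_comp /n_comp_mem; apply: eq_card => r; rewrite !inE.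
apply/andP/imsetP => [[/eqP rr rX]|[x xX ->]]; first by exists r.
by rewrite roots_root ?root_in //; apply: restr_connect_sym.
Qed.

(** Bounding by the roots of [S], not by [S] itself, lets the equality case show that [S] has
    distinct roots. *)
Lemma comps_le_roots X S :
    (forall x, x \in X -> exists2 s, s \in S & connect (restr X) x s) ->
  comps X <= #|[set fingraph.root (restr X) s | s in S]|.
Proof.
move=> dom; rewrite comps_roots.
apply/subset_leq_card/subsetP => _ /imsetP[x xX ->].
have [s sS xs] := dom x xX; apply/imsetP; exists s => //.
exact/(fingraph.rootP (restr_connect_sym X)).
Qed.

Lemma comps_le X S :
    (forall x, x \in X -> exists2 s, s \in S & connect (restr X) x s) ->
  comps X <= #|S|.
Proof. by move/comps_le_roots/leq_trans; apply; apply: leq_imset_card. Qed.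

(** A labelling that is constant along the edges of [G[X]] takes at [x] the same value as at the
    root of [x]. *)
Lemma comps_ge (T : finType) (f : G -> T) X :
    (forall x y, x \in X -> y \in X -> edge x y -> f x = f y) ->
  #|f @: X| <= comps X.
Proof.
move=> fE; rewrite comps_roots.
have fr x : f (fingraph.root (restr X) x) = f x.
  case/connectP: (connect_root (restr X) x) => p + ->.
  elim: p x => //= y p IH x /andP[/and3P[xX yX xy] /IH ->].
  by rewrite (fE x y).
apply: leq_trans (leq_imset_card f _).
apply/subset_leq_card/subsetP => _ /imsetP[x xX ->].
by rewrite -fr imset_f // imset_f.
Qed.

Lemma comps_gt0 X x : x \in X -> 0 < comps X.
Proof. by rewrite comps_roots card_gt0 => xX; apply/set0Pn; eexists; apply: imset_f xX. Qed.

Lemma comps1_connect X x y :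
  comps X <= 1 -> x \in X -> y \in X -> connect (restr X) x y.
Proof.
rewrite comps_roots => /card_le1_eqP c1 xX yX.
by apply/(fingraph.rootP (restr_connect_sym X))/c1; apply: imset_f.
Qed.

Lemma comps_lt_card X x y :
  x \in X -> y \in X -> edge x y -> comps X < #|X|.
Proof.
move=> xX yX xy; rewrite comps_roots ltn_neqAle leq_imset_card andbT.
apply/negP => /imset_injP inj.
have e : x = y.
  apply: inj => //; apply/(fingraph.rootP (restr_connect_sym X))/connect1.
  by rewrite /restr xX yX.
by rewrite e edge_irrefl in xy.
Qed.

(* A spanning forest: each non-root points to a neighbour strictly closer to
   its root, and these arcs together with their reversals are all distinct. *)
Lemma comps_forest X : 2 * #|X| <= arcs X + 2 * comps X.
Proof.
pose e := restr X; pose r := fingraph.root e.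
(* The least such [k], called [d x] below, is the distance from [x] to its root. *)
have ex x : exists k, [exists p : k.-tuple G, path e x p && (last x p == r x)].
  case/connectP: (connect_root e x) => p ep l.
  by exists (size p); apply/existsP; exists (in_tuple p); rewrite ep /= /r l eqxx.
pose d x := ex_minn (ex x).
(* Take the second vertex of a shortest path to the root: it has the same root, and the rest of the
   path bounds its distance. *)
have par x : exists y, x != r x -> e x y && (d y < d x).
  rewrite /d; case: ex_minnP => k /existsP[[p /= /eqP sp] /andP[ep /eqP l]] _.
  case: p sp ep l => [|y p] /= sp ep l; first by exists x => /eqP.
  exists y => _; case/andP: ep => exy ep; rewrite exy /= /d.
  case: ex_minnP => m _ /(_ (size p)) hm; rewrite -sp ltnS; apply: hm.
  apply/existsP; exists (in_tuple p); rewrite ep l /r /=.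
  exact/eqP/(fingraph.rootP (restr_connect_sym X))/connect1.
(* The default [x] is returned only at roots, which are excluded from [N]. *)
pose p x := odflt x [pick y | e x y && (d y < d x)].
have pP x : x != r x -> e x (p x) && (d (p x) < d x).
  move=> xr; rewrite /p; case: pickP => //= none.
  by have [y /(_ xr)] := par x; rewrite none.
pose N := [set x in X | x != r x].
have cN : #|X| = comps X + #|N|.
  rewrite comps_n_comp /n_comp_mem -(cardsID [set x | x == r x]) addnC.
  rewrite addnC; congr (_ + _); apply: eq_card => x; rewrite !inE.
    by rewrite andbC /roots eq_sym.
  by rewrite andbC.
have arcsE : arcs X = #|[set z : G * G | e z.1 z.2]|.
  transitivity (\sum_x \sum_y e x y); last first.
    rewrite pair_bigA /= -sum1_card [RHS]big_mkcond.
    by apply: eq_bigr => -[x y] _; rewrite inE /=; case: (e x y).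
  rewrite /arcs big_mkcond; apply: eq_bigr => x _; rewrite /e /restr.
  case: (x \in X) => /=; last by rewrite big1.
  by rewrite big_mkcond; apply: eq_bigr => y _; case: (y \in X).
pose A := [set (x, p x) | x in N]; pose B := [set (p x, x) | x in N].
have cA : #|A| = #|N| by apply: card_imset => x y [].
have cB : #|B| = #|N| by apply: card_imset => x y [].
(* An arc in both sets would have each endpoint strictly closer to the root than the other. *)
have AB : [disjoint A & B].
  apply/pred0P => z; apply/negbTE/negP => /= /andP[/imsetP[x xN zx] /imsetP[y yN]].
  rewrite zx => -[xpy pxy]; move: xN yN; rewrite !inE.
  case/andP=> _ /pP/andP[_ dx] /andP[_ /pP/andP[_ dy]].
  by move: dx dy; rewrite pxy -xpy; lia.
have sub : A :|: B \subset [set z : G * G | e z.1 z.2].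
  rewrite subUset; apply/andP; split; apply/subsetP => z /imsetP[x + ->];
    rewrite !inE => /andP[_ /pP/andP[ex1 _]] //=.
  by rewrite /e restr_sym.
have := subset_leq_card sub; rewrite -arcsE cardsU (disjoint_setI0 AB) cards0.
rewrite cA cB cN; lia.
Qed.
End Restriction.

(** * The data carried by [Q] *)

Definition profile (G : sgraph) : seq (nat * nat) :=
  [seq (#|X|, comps X) | X : {set G}].

Lemma coef_Q (G : sgraph) i j :
  ((Q G)`_i`_j = (count_mem (i, j) (profile G))%:R :> int)%R.
Proof.
rewrite /Q /profile count_map -sum1_count big_enum_cond /=.
rewrite !coef_sum GRing.natr_sum [RHS]big_mkcond; apply: eq_bigr => X _.
rewrite -[('Y ^+ _)%R]GRing.rmorphXn /= coefMC !coefXn xpair_eqE ![_ == i]eq_sym ![_ == j]eq_sym.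
case: (i == _); last by rewrite GRing.mul0r coef0.
by rewrite GRing.mul1r coefXn; case: eqP.
Qed.

(** The coefficients are multiplicities, and naturals embed in [int], so none is lost. *)
Lemma perm_profile (G H : sgraph) : Q G = Q H -> perm_eq (profile G) (profile H).
Proof.
move=> QGH; apply/allP => -[i j] _ /=.
by have := coef_Q G i j; rewrite QGH coef_Q => /eqP; rewrite Num.Theory.eqr_nat eq_sym.
Qed.

Lemma profile_sum (G H : sgraph) (phi : nat -> nat -> nat) : Q G = Q H ->
  \sum_(X : {set G}) phi #|X| (comps X) = \sum_(X : {set H}) phi #|X| (comps X).
Proof.
move/perm_profile => pGH.
pose f (c : nat * nat) := phi c.1 c.2.
have E (K : sgraph) : \sum_(X : {set K}) phi #|X| (comps X) = \sum_(c <- profile K) f c.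
  by rewrite /profile big_map big_enum.
by rewrite !E; apply: perm_big.
Qed.

Lemma profile_ex (G H : sgraph) (X : {set G}) : Q G = Q H ->
  exists2 Y : {set H}, #|Y| = #|X| & comps Y = comps X.
Proof.
move/perm_profile/perm_mem/(_ (#|X|, comps X)).
rewrite /profile image_f // => /esym/mapP[Y _ [-> ->]].
by exists Y.
Qed.

Lemma profile_card (G H : sgraph) : Q G = Q H -> #|G| = #|H|.
Proof.
have le (K L : sgraph) : Q K = Q L -> #|K| <= #|L|.
  by move/(profile_ex [set: K]) => [Y]; rewrite cardsT => <- _; apply: max_card.
by move=> QGH; apply/eqP; rewrite eqn_leq !le.
Qed.

(** * Sums over sets of two and three vertices *)

Section Sums.
Variable G : sgraph.
Implicit Types (x y z : G) (X : {set G}).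

Lemma sum_pairs (f : {set G} -> nat) :
  \sum_x \sum_(y | y != x) f [set x; y] = 2 * \sum_(X : {set G} | #|X| == 2) f X.
Proof.
rewrite big_distrr /=.
transitivity (\sum_(X : {set G} | #|X| == 2) \sum_(x in X) \sum_(y in X :\ x) f X).
  rewrite [RHS](exchange_big_dep xpredT) //=; apply: eq_bigr => x _.
  rewrite [RHS](exchange_big_dep (fun y => y != x)) /=; last first.
    by move=> X y _; rewrite !inE => /andP[].
  apply: eq_bigr => y yx; rewrite (big_pred1 [set x; y]) // => X /=.
  apply/andP/eqP => [[/andP[/eqP c2 xX] /setD1P[_ yX]]|->].
    apply/esym/eqP; rewrite eqEcard c2 cards2 [x == y]eq_sym yx subUset !sub1set xX yX //.
  by rewrite cards2 [x == y]eq_sym yx !inE !eqxx yx orbT.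
apply: eq_bigr => X /eqP c2.
transitivity (\sum_(x in X) f X); last by rewrite sum_nat_const c2.
apply: eq_bigr => x xX; rewrite sum_nat_const.
by have := cardsD1 x X; rewrite xX c2 => -[]; rewrite add0n => <-; rewrite mul1n.
Qed.

Definition dist3 x y z := [&& x != y, y != z & x != z].

(** A set of three vertices has six orderings: three choices of [x], then two of [y], then one of
    [z]. *)
Lemma sum_triples (f : {set G} -> nat) :
  \sum_x \sum_y \sum_(z | dist3 x y z) f [set x; y; z]
    = 6 * \sum_(X : {set G} | #|X| == 3) f X.
Proof.
rewrite big_distrr /=.
transitivity (\sum_(X : {set G} | #|X| == 3)
    \sum_(x in X) \sum_(y in X :\ x) \sum_(z in X :\ x :\ y) f X).
  rewrite [RHS](exchange_big_dep xpredT) //=; apply: eq_bigr => x _.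
  rewrite [RHS](exchange_big_dep xpredT) //=; apply: eq_bigr => y _.
  rewrite [RHS](exchange_big_dep (fun z => dist3 x y z)) /=; last first.
    move=> X z; rewrite !inE => /and3P[_ + _] /and3P[]; rewrite /dist3.
    by rewrite eq_sym => -> /=; rewrite ![_ == z]eq_sym => -> ->.
  apply: eq_bigr => z /and3P[xy yz xz]; rewrite (big_pred1 [set x; y; z]) // => X /=.
  have c3 : #|[set x; y; z]| = 3.
    by rewrite setUC cardsU1 cards2 xy !inE ![z == _]eq_sym (negbTE xz) (negbTE yz).
  rewrite !inE; apply/andP/eqP => [|->].
    case=> /andP[/andP[/eqP cX xX] /andP[_ yX]] /and3P[_ _ zX].
    by apply/esym/eqP; rewrite eqEcard cX c3 !subUset !sub1set xX yX zX.
  rewrite c3 !inE !eqxx !orbT /= ![y == x]eq_sym xy ![z == _]eq_sym.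
  by rewrite yz xz.
apply: eq_bigr => X /eqP c3.
transitivity (\sum_(x in X) 2 * f X); last by rewrite sum_nat_const c3 mulnA.
apply: eq_bigr => x xX.
have c2 : #|X :\ x| = 2 by have := cardsD1 x X; rewrite xX c3 => -[].
transitivity (\sum_(y in X :\ x) f X); last by rewrite sum_nat_const c2.
apply: eq_bigr => y yX; rewrite sum_nat_const.
by have := cardsD1 y (X :\ x); rewrite yX c2 => -[]; rewrite add0n => <-; rewrite mul1n.
Qed.

End Sums.

(** * Edges, cherries and triangles from small vertex sets *)

Section Small.
Variable G : sgraph.
Implicit Types (x y z : G) (X : {set G}).

Lemma comps_le_card X : comps X <= #|X|.
Proof. by rewrite comps_roots leq_imset_card. Qed.

Lemma comps_star X x : x \in X ->
  (forall y, y \in X -> y != x -> edge x y) -> comps X <= 1.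
Proof.
move=> xX star; rewrite -(cards1 x); apply: comps_le => y yX.
exists x; first by rewrite inE.
have [->|yx] := eqVneq y x; first exact: connect0.
by apply: connect1; rewrite /restr yX xX edge_sym star.
Qed.

(** The forest bound gives the lower estimate, and [comps_lt_card] the upper one when there is an
    edge. *)
Lemma comps_pair x y : x != y -> comps [set x; y] + edge x y = 2.
Proof.
move=> xy; have := comps_forest [set x; y]; have := comps_le_card [set x; y].
have := @comps_lt_card G [set x; y] x y; have := @comps_gt0 G [set x; y] x.
rewrite cards2 xy !inE !eqxx orbT => /(_ isT) p /(_ isT isT).
have -> : arcs [set x; y] = 2 * edge x y.
  rewrite /arcs !(big_setU1, big_set1) ?inE //=.
  by rewrite !edge_irrefl (edge_sym y x) addn0 add0n mul2n addnn.
by case: (edge x y) => [/(_ isT)|_] /=; lia.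
Qed.

(** Each edge merges two components, except the last edge of a triangle. The cyclic order of the
    edges prepares for [sum3_rot]. *)
Lemma comps_triple x y z : dist3 x y z ->
  comps [set x; y; z] + (edge x y + edge y z + edge z x)
    = 3 + [&& edge x y, edge y z & edge z x].
Proof.
case/and3P=> xy yz xz; set X := [set x; y; z].
have [xX yX zX] : [/\ x \in X, y \in X & z \in X] by rewrite !inE !eqxx !orbT.
have cX : #|X| = 3.
  by rewrite /X setUC cardsU1 cards2 xy !inE ![z == _]eq_sym (negbTE xz) (negbTE yz).
have aX : arcs X = 2 * (edge x y + edge y z + edge z x).
  rewrite /arcs /X setUC.
  rewrite !(big_setU1, big_set1) ?inE ?[z == _]eq_sym ?negb_or ?xz ?yz //=.
  by rewrite !edge_irrefl (edge_sym y x) (edge_sym z y) (edge_sym x z); lia.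
(* Any two of the three possible edges share a vertex [u], which then dominates [X]. *)
have star u v w : X = [set u; v; w] -> edge u v -> edge u w -> comps X <= 1.
  move=> XE uv uw; apply: (@comps_star _ u); first by rewrite XE !inE eqxx.
  by move=> t; rewrite XE !inE => /orP[/orP[]|] /eqP-> //; rewrite eqxx.
have s1 := star x y z erefl.
have s2 : edge y z -> edge y x -> comps X <= 1.
  by apply: (star y z x); apply/setP=> t; rewrite !inE; case: (t == x); case: (t == y); case: (t == z).
have s3 : edge z x -> edge z y -> comps X <= 1.
  by apply: (star z x y); apply/setP=> t; rewrite !inE; case: (t == x); case: (t == y); case: (t == z).
have := comps_forest X; have := comps_le_card X; rewrite cX aX.
have := comps_gt0 xX.
have := comps_lt_card xX yX; have := comps_lt_card yX zX; have := comps_lt_card zX xX.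
rewrite cX; move: s1 s2 s3; rewrite (edge_sym y x) (edge_sym z y) (edge_sym x z).
case: (edge x y); case: (edge y z); case: (edge z x) => /=; lia.
Qed.

Definition sum3 (f : G -> G -> G -> nat) : nat :=
  \sum_x \sum_y \sum_(z | dist3 x y z) f x y z.

Lemma dist3_rot x y z : dist3 y z x = dist3 x y z.
Proof. by rewrite /dist3 (eq_sym z x) (eq_sym y x); case: (x != y); case: (y != z); case: (x != z). Qed.

Lemma eq_sum3 f g : (forall x y z, dist3 x y z -> f x y z = g x y z) ->
  sum3 f = sum3 g.
Proof.
by move=> fg; do 2![apply: eq_bigr => ? _]; apply: eq_bigr => z; apply: fg.
Qed.

Lemma sum3D f g : sum3 (fun x y z => f x y z + g x y z) = sum3 f + sum3 g.
Proof.
rewrite /sum3 -big_split /=; apply: eq_bigr => x _.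
by rewrite -big_split /=; apply: eq_bigr => y _; rewrite -big_split /=.
Qed.

Lemma sum3_rot f : sum3 (fun x y z => f y z x) = sum3 f.
Proof.
rewrite /sum3 exchange_big; apply: eq_bigr => y _ /=.
under eq_bigr => i _ do rewrite big_mkcond.
rewrite exchange_big; apply: eq_bigr => z _; rewrite [RHS]big_mkcond.
by apply: eq_bigr => x _; rewrite [in RHS]dist3_rot.
Qed.

(** Paths [x y z], not necessarily induced, each counted once per orientation. *)
Definition cherries : nat := sum3 (fun x y z => edge x y * edge y z).

(** Six times the number of triangles. *)
Definition triangles : nat :=
  sum3 (fun x y z => [&& edge x y, edge y z & edge z x] : nat).

(** The right side is left as a sum over pairs so that [sum_comps_eq] transfers it as well. *)
Lemma sum_deg_comps :
  2 * (\sum_(X : {set G} | #|X| == 2) comps X) + \sum_(x : G) deg x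
    = 2 * \sum_(X : {set G} | #|X| == 2) 2.
Proof.
rewrite -(sum_pairs (fun X => comps X)) -(sum_pairs (fun=> 2)) -big_split /=.
apply: eq_bigr => x _.
rewrite /deg [X in _ + X](bigD1 x) //= edge_irrefl add0n -big_split /=.
by apply: eq_bigr => y yx; rewrite -(@comps_pair x y) // eq_sym.
Qed.

Lemma sum3_edge : sum3 (fun x y z => edge x y) = (#|G| - 2) * \sum_(x : G) deg x.
Proof.
rewrite big_distrr; apply: eq_bigr => x _; rewrite big_distrr; apply: eq_bigr => y _.
rewrite sum_nat_const /=; case xy: (edge x y); last by rewrite !muln0.
have nxy : x != y by apply: contraTneq xy => ->; rewrite edge_irrefl.
rewrite !muln1; have := cardsC [set x; y]; rewrite cards2 nxy => <-.
rewrite addKn; apply: eq_card => z.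
by rewrite in_setC !inE negb_or ![z == _]eq_sym andbC.
Qed.

(** Summing [comps_triple], the three edge terms contribute equally by rotation. This expresses
    [triangles] by quantities that [Q] determines. *)
Lemma sum3_comps :
  6 * (\sum_(X : {set G} | #|X| == 3) comps X) + 3 * ((#|G| - 2) * \sum_(x : G) deg x)
    = 6 * (\sum_(X : {set G} | #|X| == 3) 3) + triangles.
Proof.
rewrite -sum3_edge -(sum_triples (fun X => comps X)) -(sum_triples (fun=> 3)).
rewrite -/(sum3 (fun x y z => comps [set x; y; z])) -/(sum3 (fun _ _ _ => 3)).
rewrite -sum3D -(eq_sum3 comps_triple) sum3D; congr (_ + _).
rewrite !sum3D (sum3_rot (fun x y z => edge y z)) (sum3_rot (fun x y z => edge x y)).
lia.
Qed.

(** A connected triple is a path, with one centre, or a triangle, with three possible centres: hence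
    the correction by two per triangle. *)
Lemma sum3_connected :
  6 * (\sum_(X : {set G} | #|X| == 3) (comps X == 1)) + 2 * triangles
    = 3 * cherries.
Proof.
rewrite -(sum_triples (fun X => (comps X == 1) : nat)).
rewrite -/(sum3 (fun x y z => (comps [set x; y; z] == 1) : nat)).
rewrite mul2n -addnn /triangles /cherries -!sum3D.
pose f x y z := edge x y * edge y z.
transitivity (sum3 (fun x y z => f x y z + f y z x + f z x y)).
  apply: eq_sum3 => x y z /comps_triple; rewrite /f.
  by case: (edge x y); case: (edge y z); case: (edge z x) => /=; case: eqP; lia.
rewrite !sum3D (sum3_rot (fun x y z => f y z x)) (sum3_rot f) -/cherries; lia.
Qed.

(** The square of [deg y] counts ordered pairs of neighbours of [y]; the distinct pairs are cherries
    and the equal ones number [deg y]. *)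
Lemma cherries_deg : cherries + \sum_(x : G) deg x = \sum_(x : G) deg x ^ 2.
Proof.
have -> : cherries = \sum_(y : G) \sum_(x : G) \sum_(z | z != x) edge x y * edge y z.
  rewrite /cherries /sum3 exchange_big; apply: eq_bigr => y _; apply: eq_bigr => x _.
  rewrite big_mkcond [RHS]big_mkcond; apply: eq_bigr => z _; rewrite /dist3.
  have [->|xy] := eqVneq x y; first by rewrite edge_irrefl if_same mul0n.
  have [->|yz] := eqVneq y z; first by rewrite edge_irrefl muln0 if_same.
  by rewrite /= eq_sym.
rewrite -big_split /=; apply: eq_bigr => y _ /=.
rewrite -mulnn {1 2}/deg big_distrl -big_split; apply: eq_bigr => x _ /=.
rewrite -big_distrr /= (edge_sym x y) /deg [X in _ = _ * X](bigD1 x) //=.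
by case: (edge y x) => /=; lia.
Qed.

Lemma triangles_eq0 : triangles = 0 ->
  forall x y z, edge x y -> edge y z -> ~~ edge z x.
Proof.
move=> /eqP; rewrite /triangles /sum3 sum_nat_eq0 => /forallP h x y z xy yz.
apply/negP => zx; have := h x; rewrite sum_nat_eq0 => /forallP/(_ y).
rewrite sum_nat_eq0 => /forallP/(_ z); rewrite xy yz zx /= implybF => /negP; apply.
have neq u v : edge u v -> u != v by apply: contraTneq => ->; rewrite edge_irrefl.
by rewrite /dist3 !neq // edge_sym.
Qed.

End Small.

(** * Invariants determined by [Q] *)

Lemma sum_comps_eq (G H : sgraph) k (phi : nat -> nat) : Q G = Q H ->
  \sum_(X : {set G} | #|X| == k) phi (comps X)
    = \sum_(X : {set H} | #|X| == k) phi (comps X).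
Proof.
move/(profile_sum (fun i j => if i == k then phi j else 0)).
by rewrite -!big_mkcond.
Qed.

Section Invariants.
Variables (G H : sgraph).
Hypothesis QGH : Q G = Q H.

Lemma sum_deg_eq : \sum_(x : G) deg x = \sum_(x : H) deg x.
Proof.
have := sum_deg_comps G; have := sum_deg_comps H.
by rewrite (sum_comps_eq 2 id QGH) (sum_comps_eq 2 (fun=> 2) QGH); lia.
Qed.

Lemma triangles_eq : triangles G = triangles H.
Proof.
have := sum3_comps G; have := sum3_comps H.
rewrite (sum_comps_eq 3 id QGH) (sum_comps_eq 3 (fun=> 3) QGH).
by rewrite sum_deg_eq (profile_card QGH); lia.
Qed.

Lemma sum_sqr_deg_eq : \sum_(x : G) deg x ^ 2 = \sum_(x : H) deg x ^ 2.
Proof.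
rewrite -!cherries_deg sum_deg_eq; have := sum3_connected G; have := sum3_connected H.
by rewrite (sum_comps_eq 3 (fun c => c == 1 : nat) QGH) triangles_eq; lia.
Qed.

End Invariants.

(** * Degrees and vertex deletions in the book *)

Section BookGraph.
Variable n : nat.
Notation B := (book n).

Lemma card_book : #|B| = 2 * n + 2.
Proof. by rewrite card_sum card_prod card_bool card_ord; lia. Qed.

Lemma sum_book (f : B -> nat) :
  \sum_v f v = f (inl false) + f (inl true)
               + \sum_(i < n) (f (inr (i, false)) + f (inr (i, true))).
Proof.
have -> : \sum_v f v = \sum_(v : bool + 'I_n * bool) f v by [].
rewrite big_sumType /= big_bool addnC [f _ + f _]addnC addnC; congr (_ + _).
transitivity (\sum_(i < n) \sum_(b : bool) f (inr (i, b))).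
  by rewrite pair_bigA; apply: eq_bigr => -[].
by apply: eq_bigr => i _; rewrite big_bool addnC.
Qed.

Lemma deg_spine (c : bool) : deg (inl c : B) = n.+1.
Proof.
rewrite /deg sum_book /=.
rewrite (eq_bigr (fun=> 1)) => [|i _]; last by case: c.
by rewrite sum1_card card_ord; case: c.
Qed.

Lemma deg_page (p : 'I_n * bool) : deg (inr p : B) = 2.
Proof.
case: p => i c; rewrite /deg sum_book /= (bigD1 i) //= eqxx big1 => [|j ji].
  by case: c.
by rewrite eq_sym (negbTE ji).
Qed.

Lemma sum_deg_book : \sum_(v : B) deg v = 6 * n + 2.
Proof.
rewrite sum_book !deg_spine; under eq_bigr => i _ do rewrite !deg_page.
by rewrite sum_nat_const card_ord; lia.
Qed.

Lemma sum_sqr_deg_book : \sum_(v : B) deg v ^ 2 = 2 * n ^ 2 + 12 * n + 2.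
Proof.
rewrite sum_book !deg_spine; under eq_bigr => i _ do rewrite !deg_page.
by rewrite sum_nat_const card_ord; lia.
Qed.

Lemma triangles_book : triangles B = 0.
Proof.
rewrite /triangles /sum3 big1 // => x _; rewrite big1 // => y _.
rewrite big1 // => z _; apply/eqP; rewrite eqb0.
case: x y z => [a|[i a]] [b|[j b]] [c|[k c]] //=;
  case: a; case: b; case: c; rewrite ?andbF //.
Qed.

(** A surviving spine vertex reaches every other vertex in at most two steps: through the page if
    the other spine vertex is deleted, through the spine otherwise. *)
Lemma comps_book_del (w : B) : comps (~: [set w]) <= 1.
Proof.
have conn (X : {set B}) (x y : B) : x \in X -> y \in X -> edge x y -> connect (restr X) x y.
  by move=> xX yX xy; apply: connect1; rewrite /restr xX yX.
have conn2 (X : {set B}) (x y z : B) : x \in X -> y \in X -> z \in X -> edge x y -> edge y z ->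
    connect (restr X) x z.
  by move=> xX yX zX xy yz; apply: (connect_trans (conn X x y _ _ _)); rewrite ?conn.
case: w => [c|p].
  rewrite -(cards1 (inl (~~ c) : B)); apply: comps_le => x.
  rewrite !inE => xc; exists (inl (~~ c)); rewrite ?inE //.
  case: x xc => [a|[i a]] xc.
    by have -> : a = ~~ c by case: a c xc => [] [].
  have [->|ac] := eqVneq a (~~ c); first by apply: conn; rewrite ?inE /= ?eqxx //; case: c {xc}.
  apply: (conn2 _ _ (inr (i, ~~ c))); rewrite ?inE /= ?eqxx //; case: a c ac xc => [] [] //.
rewrite -(cards1 (inl false : B)); apply: comps_le => x.
rewrite !inE => xp; exists (inl false); rewrite ?inE //.
case: x xp => [[]|[i []]] xp; last 1 first.
- by apply: conn; rewrite ?inE.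
- by apply: conn; rewrite ?inE.
- exact: connect0.
- by apply: (conn2 _ _ (inl true)); rewrite ?inE.
Qed.

Lemma comps_book_spine : comps (~: [set inl false; inl true] : {set B}) = n.
Proof.
apply/eqP; rewrite eqn_leq; apply/andP; split.
  rewrite -[n in _ <= n]card_ord -cardsT.
  apply: leq_trans (leq_imset_card (fun i => inr (i, false) : B) _).
  apply: comps_le => -[[]|[i a]]; rewrite !inE // => _.
  exists (inr (i, false)); first by apply: imset_f.
  case: a; last exact: connect0.
  by apply: connect1; rewrite /restr !inE /= eqxx.
(* The page index is constant along edges off the spine; [None] occurs only on the deleted spine. *)
pose f (v : B) := if v is inr (i, _) then Some i else None.
apply: leq_trans (comps_ge (f := f) _).
  rewrite -[n in n <= _]card_ord -cardsT -(card_imset _ (@Some_inj _)).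
  apply/subset_leq_card/subsetP => _ /imsetP[i _ ->].
  by apply/imsetP; exists (inr (i, false)); rewrite ?inE.
by move=> [[]|[i a]] [[]|[j b]]; rewrite !inE //= => _ _ /andP[/eqP->].
Qed.

(** If a spine vertex is deleted, one vertex per page meets all components; if only page vertices
    are, the two spine vertices do. *)
Lemma comps_book_pair (a b : B) : 1 < n -> a != b -> comps (~: [set a; b]) <= n.
Proof.
move=> n_gt1 ab.
have inr_eq (i j : 'I_n) (c d : bool) :
    (inr (i, c) == inr (j, d) :> bool + 'I_n * bool) = (i == j) && (c == d) by [].
have mixed (c : bool) (p : 'I_n * bool) :
    comps (~: [set inl c; inr p] : {set B}) <= n.
  case: p => i d; have [j ji] : exists j : 'I_n, j != i.
    have : 0 < #|predC1 i| by rewrite cardC1 card_ord; lia.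
    by case/card_gt0P => j; exists j.
  (* On page [i] this is the surviving vertex, elsewhere the neighbour of the surviving spine
     vertex. That spine vertex is attached to page [j], which exists because [1 < n]. *)
  pose s k : B := inr (k, if k == i then ~~ d else ~~ c).
  rewrite -[n in _ <= n]card_ord -cardsT.
  apply: leq_trans (leq_imset_card s _); apply: comps_le => -[e|[k e]]; rewrite !inE /=.
    rewrite orbF => ec; exists (s j); first exact: imset_f.
    apply: connect1; rewrite /restr !inE /s /= (negbTE ji) /= !orbF ec.
    by rewrite inr_eq (negbTE ji); case: e c {s} ec => [] [].
  move=> kd; exists (s k); first exact: imset_f.
  have [<-|ke] := eqVneq (inr (k, e) : B) (s k); first exact: connect0.
  apply: connect1; rewrite /restr !inE kd /= eqxx /=; move: ke kd; rewrite /s.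
  rewrite !inr_eq eqxx.
  by case: (k == i) => /=; case: e d c {s} => [] [] [].
case: a b ab => [c|p] [d|q] ab.
- have -> : [set inl c; inl d] = [set inl false; inl true] :> {set B}.
    apply/setP => x; rewrite !inE; case: c d ab => [] [] //= _.
    by rewrite orbC.
  by rewrite comps_book_spine.
- exact: mixed.
- by rewrite setUC mixed.
apply: leq_trans n_gt1; have <- : #|[set inl false; inl true] : {set B}| = 2.
  by rewrite cards2.
apply: comps_le => -[e|[k e]]; rewrite !inE => kpq.
  by exists (inl e); rewrite ?connect0 // !inE; case: (e).
exists (inl e); first by rewrite !inE; case: (e).
by apply: connect1; rewrite /restr !inE kpq /= eqxx.
Qed.

End BookGraph.

Lemma isomorphic_sym (G H : sgraph) : isomorphic G H -> isomorphic H G.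
Proof.
case=> f [[g fK gK] fE]; exists g; split; first by exists f.
by move=> x y; rewrite -fE !gK.
Qed.

(** * Deleting one or two vertices *)

Section Cover.
Variable G : sgraph.
Implicit Types (x y z a b : G) (X S : {set G}).

Definition nbrs x : {set G} := [set y | edge x y].

Lemma card_nbrs x : #|nbrs x| = deg x.
Proof. by rewrite -sum1_card big_mkcond; apply: eq_bigr => y _; rewrite inE; case: edge. Qed.

(** The components number at most the roots of [S], hence at most [#|S|]; equality makes the root
    map injective on [S]. *)
Lemma connect_transversal_inj X S :
    (forall x, x \in X -> exists2 s, s \in S & connect (restr X) x s) ->
  #|S| <= comps X -> {in S &, forall s t, connect (restr X) s t -> s = t}.
Proof.
move=> dom leS s t sS tS /(fingraph.rootP (restr_connect_sym X)).
suff /imset_injP inj : #|fingraph.root (restr X) @: S| == #|S| by apply: inj.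
rewrite eqn_leq leq_imset_card.
exact: leq_trans leS (comps_le_roots dom).
Qed.

(** Some path from [x] to [a] avoids [b]; the vertex just before its first visit to [a] is the
    required neighbour. *)
Lemma cover_nbrs a b x : a != b -> comps (~: [set b]) <= 1 ->
    x \in ~: [set a; b] ->
  exists2 w, w \in nbrs a :\ b & connect (restr (~: [set a; b])) x w.
Proof.
move=> ab del; set X := ~: _ => xX.
have : connect (restr (~: [set b])) x a.
  apply: comps1_connect => //; rewrite !inE //.
  by move: xX; rewrite !inE negb_or => /andP[].
case/connectP => p; elim: p x xX => [|y p IH] x xX /=.
  by move=> _ ax; move: xX; rewrite -ax /X !inE eqxx.
case/andP=> /and3P[xb yb xy] yp l.
have [ya|ya] := eqVneq y a.
  exists x; last exact: connect0.
  by move: xb; rewrite !inE edge_sym -ya xy => ->.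
have yX : y \in X by move: yb; rewrite !inE negb_or ya => ->.
have [w wA yw] := IH y yX yp l; exists w => //.
by apply: connect_trans yw; apply: connect1; rewrite /restr xX yX.
Qed.

Lemma comps_le_deg a b : a != b -> comps (~: [set b]) <= 1 ->
  comps (~: [set a; b]) <= #|nbrs a :\ b|.
Proof. by move=> ab del; apply: comps_le => x; apply: cover_nbrs. Qed.

(** For any [v] other than [x], a path avoiding [v] leads from [x] to a third vertex, so [x] has a
    neighbour other than [v]. Using this twice gives two neighbours. *)
Lemma min_deg : 2 < #|G| -> (forall v : G, comps (~: [set v]) <= 1) ->
  forall x, 1 < deg x.
Proof.
move=> cG del x; have third (u : G) : exists z, z \notin [set x; u].
  have : 0 < #|~: [set x; u]|.
    by move: cG; rewrite -(cardsC [set x; u]) cards2; case: (x != u) => /=; lia.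
  by case/card_gt0P => z; rewrite inE; exists z.
have nbr v : v != x -> exists2 y, edge x y & y != v.
  move=> vx; have [z zvx] := third v; move: zvx; rewrite !inE negb_or => /andP[zx zv].
  have : connect (restr (~: [set v])) x z.
    by apply: comps1_connect; rewrite ?inE // eq_sym.
  case/connect_restr_step; first by rewrite eq_sym.
  by move=> y /and3P[_ yv xy] _; exists y => //; move: yv; rewrite !inE.
have [v vx] := third x; rewrite !inE orbb in vx.
have [y xy _] := nbr v vx.
have yx : y != x by apply: contraTneq xy => ->; rewrite edge_irrefl.
have [z xz zy] := nbr y yx.
rewrite -card_nbrs; apply: leq_trans (_ : #|[set y; z]| <= _).
  by rewrite cards2 eq_sym zy.
by apply/subset_leq_card/subsetP => w; rewrite !inE => /orP[] /eqP->.
Qed.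

(** Deleting [a] and [b] destroys [deg a + deg b] edges, less one if they are adjacent; everything
    is doubled since arcs are counted. *)
Lemma arcs_pair a b : a != b ->
  arcs (~: [set a; b]) + 2 * (deg a + deg b) = \sum_(x : G) deg x + 2 * edge a b.
Proof.
move=> ab; pose X := ~: [set a; b].
have split (f : G -> nat) : \sum_x f x = \sum_(x in X) f x + f a + f b.
  rewrite (bigID (mem X)) /= -addnA; congr (_ + _).
  transitivity (\sum_(x in [set a; b]) f x).
    by apply: eq_bigl => x; rewrite /X inE negbK.
  by rewrite big_setU1 ?big_set1 // inE.
have E x : \sum_(y in X) edge x y + edge x a + edge x b = deg x by rewrite /deg split.
rewrite split (_ : \sum_(x in X) deg x =
    arcs X + \sum_(x in X) edge x a + \sum_(x in X) edge x b); last first.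
  by rewrite /arcs -!big_split; apply: eq_bigr => x _ /=; rewrite E.
have S y : \sum_(x in X) edge x y = \sum_(x in X) edge y x.
  by apply: eq_bigr => x _; rewrite edge_sym.
have := E a; have := E b; rewrite !S !edge_irrefl (edge_sym b a) -/X; lia.
Qed.

End Cover.

(** * Reconstructing the book from an adjacent pair *)

Lemma isomorphic_book (n : nat) (H : sgraph) (a b : H) :
    edge a b -> #|H| = 2 * n + 2 ->
    (forall x y z : H, edge x y -> edge y z -> ~~ edge z x) ->
    (forall v : H, comps (~: [set v]) <= 1) ->
    n <= comps (~: [set a; b]) ->
  isomorphic H (book n).
Proof.
move=> ab cH tri del nX; set X := ~: [set a; b].
have nab : a != b by apply: contraTneq ab => ->; rewrite edge_irrefl.
have nba : b != a by rewrite eq_sym.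
pose A := nbrs a :\ b; pose B := nbrs b :\ a.
have covA x : x \in X -> exists2 w, w \in A & connect (restr X) x w.
  exact: cover_nbrs.
have covB x : x \in X -> exists2 w, w \in B & connect (restr X) x w.
  by rewrite /X setUC; apply: cover_nbrs.
have AB : [disjoint A & B].
  apply/pred0P => x; apply/negbTE/negP => /= /andP[]; rewrite !inE.
  case/andP=> _ ax /andP[_ bx]; have := tri a b x ab bx.
  by rewrite edge_sym ax.
have AX : A \subset X.
  apply/subsetP => x; rewrite !inE => /andP[xb ax]; rewrite negb_or xb andbT.
  by apply: contraTneq ax => ->; rewrite edge_irrefl.
have BX : B \subset X.
  apply/subsetP => x; rewrite !inE => /andP[xa bx]; rewrite negb_or xa /=.
  by apply: contraTneq bx => ->; rewrite edge_irrefl.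
have cX : #|X| = 2 * n by have := cardsC [set a; b]; rewrite cards2 nab cH -/X; lia.
have cAB : #|A| + #|B| <= 2 * n.
  rewrite -cX -cardsUI (disjoint_setI0 AB) cards0 addn0.
  by rewrite subset_leq_card // subUset AX BX.
have cA : comps X <= #|A| by apply: comps_le.
have cB : comps X <= #|B| by apply: comps_le.
(* [A] and [B] each have at least [n] elements and fit disjointly into [2 * n] vertices, so both
   bounds are tight. *)
rewrite -/X in nX; have {}cA : #|A| = n by lia.
have {}cB : #|B| = n by lia.
have injA : {in A &, forall s t, connect (restr X) s t -> s = t}.
  by apply: connect_transversal_inj; rewrite ?cA.
have injB : {in B &, forall s t, connect (restr X) s t -> s = t}.
  by apply: connect_transversal_inj; rewrite ?cB.
have UX x : x \in X -> (x \in A) || (x \in B).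
  rewrite -in_setU; have /eqP-> // : A :|: B == X.
  by rewrite eqEcard subUset AX BX cardsU (disjoint_setI0 AB) cards0 cA cB cX /=; lia.
(* The first step from [w] towards [w'] cannot end in [A], which meets each component once; it ends
   in [B], hence at [w']. *)
have matchA w : w \in A -> exists2 w', w' \in B & edge w w' && connect (restr X) w w'.
  move=> wA; have wX := subsetP AX w wA; have [w' w'B ww'] := covB w wX.
  exists w' => //; rewrite ww' andbT.
  have nww' : w != w'.
    by apply: contraTneq wA => ->; rewrite (disjointFl AB).
  have [y wy yw'] := connect_restr_step ww' nww'; have /and3P[_ yX ewy] := wy.
  case/orP: (UX y yX) => yS.
    by rewrite (injA w y) ?connect1 ?edge_irrefl // in ewy.
  suff -> : w' = y by [].
  apply: injB => //; apply: connect_trans yw'.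
  by rewrite restr_connect_sym.
pose al (i : 'I_n) : H := enum_val (cast_ord (esym cA) i).
have alA i : al i \in A by apply: enum_valP.
have al_inj : injective al by move=> i j /enum_val_inj/cast_ord_inj.
have /fin_all_exists[be beP] : forall i : 'I_n, exists w : H,
    [/\ w \in B, edge (al i) w & connect (restr X) (al i) w].
  by move=> i; have [w wB /andP[]] := matchA _ (alA i); exists w.
have a_al i : edge a (al i) by have := alA i; rewrite !inE => /andP[].
have b_be i : edge b (be i) by have [+ _ _] := beP i; rewrite !inE => /andP[].
have a_be i : edge a (be i) = false.
  by apply/negbTE; rewrite edge_sym; apply: tri ab (b_be i).
have b_al i : edge b (al i) = false.
  by apply/negbTE; rewrite edge_sym; apply: tri (a_al i); rewrite edge_sym.
have al_al i j : edge (al i) (al j) = false.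
  by apply/negbTE; apply: tri (a_al i); rewrite edge_sym.
have be_be i j : edge (be i) (be j) = false.
  by apply/negbTE; apply: tri (b_be i); rewrite edge_sym.
(* An edge from [al i] to [be j] puts [al i] and [al j] in one component, where [A] has a single
   vertex. *)
have al_be i j : edge (al i) (be j) = (i == j).
  apply/idP/eqP => [e|->]; last by have [] := beP j.
  apply/al_inj/injA => //; have [bB _ c] := beP j.
  apply: (@connect_trans _ _ (be j)); last by rewrite restr_connect_sym.
  apply: connect1; rewrite /restr e (subsetP AX) //.
  by rewrite (subsetP BX).
pose f (v : book n) : H := match v with
  | inl false => a | inl true => b
  | inr (i, false) => al i | inr (i, true) => be i end.
have fE x y : edge (f x) (f y) = edge x y.
  case: x y => [[]|[i []]] [[]|[j []]] //=;
    rewrite ?edge_irrefl ?ab ?(edge_sym b a) ?a_al ?b_be ?a_be ?b_al ?al_al ?be_be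
            ?al_be ?andbT ?andbF //.
  all: try by rewrite edge_sym ?a_al ?b_be ?a_be ?b_al ?al_be // eq_sym.
have aX : a \notin X by rewrite !inE eqxx.
have bX : b \notin X by rewrite !inE eqxx orbT.
have alX i : al i \in X by apply: (subsetP AX).
have beX i : be i \in X by have [bB _ _] := beP i; apply: (subsetP BX).
have al_neq_be i j : al i <> be j by move=> e; have := a_al i; rewrite e a_be.
have be_inj : injective be.
  by move=> i j e; apply/eqP; rewrite -al_be -e al_be.
have neqX v w : v \notin X -> w \in X -> v <> w by move=> + + e; rewrite e => /negP.
have f_inj : injective f.
  case=> [[]|[i []]] [[]|[j []]] //= e; try by move/eqP: nab; rewrite e.
  all: try by [case: (neqX _ _ aX (alX j)) | case: (neqX _ _ aX (beX j))
             | case: (neqX _ _ bX (alX j)) | case: (neqX _ _ bX (beX j))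
             | case: (neqX _ _ aX (alX i)) | case: (neqX _ _ aX (beX i))
             | case: (neqX _ _ bX (alX i)) | case: (neqX _ _ bX (beX i))
             | case: (al_neq_be i j) | case: (al_neq_be j i)
             | rewrite (al_inj _ _ e) | rewrite (be_inj _ _ e)].
apply: isomorphic_sym; exists f; split=> //.
by apply: inj_card_bij => //; rewrite cH card_book.
Qed.

(** * Finding an adjacent pair by degree sums *)

Lemma sum_leq_sum_sqr (I : finType) (P : pred I) (f : I -> nat) :
  \sum_(i | P i) f i <= \sum_(i | P i) f i ^ 2.
Proof. by apply: leq_sum => i _; case: (f i) => // k; rewrite -mulnn leq_pmulr. Qed.

Lemma sum_sqr_leq_sqr_sum (I : finType) (P : pred I) (f : I -> nat) :
  \sum_(i | P i) f i ^ 2 <= (\sum_(i | P i) f i) ^ 2.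
Proof.
rewrite -[X in _ <= X]mulnn big_distrl; apply: leq_sum => i Pi /=.
by rewrite -mulnn leq_mul2l (bigD1 i) //= leq_addr orbT.
Qed.

Lemma profile_setC (G H : sgraph) (X : {set G}) : Q G = Q H ->
  exists2 Y : {set H}, #|Y| = #|X| & comps (~: Y) = comps (~: X).
Proof.
move=> QGH; have [Y cY <-] := profile_ex (~: X) QGH.
exists (~: Y); last by rewrite setCK.
by rewrite cardsCs setCK cY [RHS]cardsCs (profile_card QGH).
Qed.

Lemma profile_del2 (G H : sgraph) (a b : G) : Q G = Q H -> a != b ->
  exists c d : H, c != d /\ comps (~: [set c; d]) = comps (~: [set a; b]).
Proof.
move=> QGH ab; have [Y + <-] := profile_setC [set a; b] QGH.
by rewrite cards2 ab => /eqP/cards2P[c [d [cd ->]]]; exists c, d.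
Qed.

Section Uniqueness.
Variables (n : nat) (H : sgraph).
Hypotheses (n_gt0 : 0 < n) (QH : Q H = Q (book n)).
Implicit Types a b p q : H.

Let card_H : #|H| = 2 * n + 2.
Proof. by rewrite (profile_card QH) card_book. Qed.

Let sum_deg_H : \sum_(x : H) deg x = 6 * n + 2.
Proof. by rewrite (sum_deg_eq QH) sum_deg_book. Qed.

Let sum_sqr_deg_H : \sum_(x : H) deg x ^ 2 = 2 * n ^ 2 + 12 * n + 2.
Proof. by rewrite (sum_sqr_deg_eq QH) sum_sqr_deg_book. Qed.

Let triangle_free x y z : @edge H x y -> edge y z -> ~~ edge z x.
Proof. by apply: triangles_eq0; rewrite (triangles_eq QH) triangles_book. Qed.

Let comps_del (v : H) : comps (~: [set v]) <= 1.
Proof.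
have [Y + <-] := profile_setC [set v] QH.
by rewrite cards1 => /eqP/cards1P[w ->]; apply: comps_book_del.
Qed.

Let deg_gt1 (x : H) : 1 < deg x.
Proof. by apply: min_deg => //; rewrite card_H; lia. Qed.

Let card_del2 a b : a != b -> #|~: [set a; b]| = 2 * n.
Proof. by move=> ab; rewrite cardsCs setCK cards2 ab card_H; lia. Qed.

Let deg_ge a b : a != b -> comps (~: [set a; b]) <= deg a.
Proof.
move=> ab; apply: leq_trans (comps_le_deg ab (comps_del b)) _.
by rewrite -card_nbrs subset_leq_card // subsetDl.
Qed.

(** By [deg_gt1] the subtraction never truncates. *)
Let excess (x : H) := deg x - 2.

Let sum_excess (P : pred H) :
  \sum_(x | P x) deg x = \sum_(x | P x) excess x + 2 * \sum_(x | P x) 1.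
Proof.
rewrite big_distrr -big_split; apply: eq_bigr => x _ /=.
by have := deg_gt1 x; rewrite /excess; lia.
Qed.

Let sum_sqr_excess (P : pred H) :
  \sum_(x | P x) deg x ^ 2
    = \sum_(x | P x) excess x ^ 2 + 4 * \sum_(x | P x) excess x
      + 4 * \sum_(x | P x) 1.
Proof.
rewrite !big_distrr -!big_split; apply: eq_bigr => x _ /=.
have := deg_gt1 x; rewrite /excess; case: (deg x) => [|[|d]] // _.
by rewrite !subSS subn0 -!mulnn; lia.
Qed.

(* s is the total excess of the degrees over 2 outside {a, b}, t the sum of its
   squares, so s <= t <= s ^ 2 with s = 2n + 2 - deg a - deg b in {1, 2}. *)
Let nonadjacent_n2 a b :
  a != b -> ~~ edge a b -> comps (~: [set a; b]) = n -> n = 2.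
Proof.
move=> ab nab cn; have ba : b != a by rewrite eq_sym.
have da : n <= deg a by rewrite -{1}cn deg_ge.
have db : n <= deg b by rewrite -{1}cn setUC deg_ge.
(* The remaining [2 * n] vertices form [n] components, so at least [n] of the [3 * n + 1] edges
   avoid [a] and [b]. *)
have dab : deg a + deg b <= 2 * n + 1.
  have := comps_forest (~: [set a; b]); rewrite card_del2 // cn.
  by have := arcs_pair ab; rewrite sum_deg_H (negbTE nab); lia.
pose P x := (x != a) && (x != b).
have split (f : H -> nat) : \sum_x f x = f a + (f b + \sum_(x | P x) f x).
  by rewrite (bigD1 a) //= (bigD1 b).
have cP : \sum_(x | P x) 1 = 2 * n.
  by have := split (fun=> 1); rewrite sum1_card card_H; lia.
have := sum_excess P; have := sum_sqr_excess P; rewrite cP.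
have := split (@deg H); have := split (fun x => deg x ^ 2).
rewrite sum_deg_H sum_sqr_deg_H.
have := sum_leq_sum_sqr P excess; have := sum_sqr_leq_sqr_sum P excess.
move: (\sum_(x | P x) excess x) (\sum_(x | P x) excess x ^ 2) => s t.
move: (\sum_(x | P x) deg x) (\sum_(x | P x) deg x ^ 2) => u v.
move: (deg a) (deg b) da db dab => A B nA nB AB ts st E1 E2 E3 E4.
(* If A = B = n then s = 2 and t = 4n - 6; otherwise s = 1 and t = 2n - 3. Either way s <= t <= s^2
   leaves only n = 2. *)
have [AE|[AE|AE]] : A + B = 2 * n \/ A = n + 1 /\ B = n \/ A = n /\ B = n + 1 by lia.
- have [A_n B_n] : A = n /\ B = n by lia.
  have s2 : s = 2 by lia.
  by subst; nia.
- case: AE => A_n B_n; have s1 : s = 1 by lia.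
  by subst; nia.
- case: AE => A_n B_n; have s1 : s = 1 by lia.
  by subst; nia.
Qed.

Let adjacent_n2 : n = 2 ->
  exists a b, edge a b /\ n <= comps (~: [set a; b]).
Proof.
move=> n2; have := sum_excess xpredT; have := sum_sqr_excess xpredT.
rewrite sum_deg_H sum_sqr_deg_H sum1_card card_H n2 => E2 E1.
have [p ep] : exists p, 0 < excess p.
  apply/existsP; apply: contraT => /existsPn e0; move: E1.
  by rewrite big1 => // x _; have := e0 x; case: (excess x).
(* The excesses sum to 2 and so do their squares; a single vertex of excess 2 would make the latter
   sum 4. *)
have [q qp eq] : exists2 q, q != p & 0 < excess q.
  apply/exists_inP; apply: contraT => /exists_inPn e0; move: E1 E2.
  have e0' x : x != p -> excess x = 0 by move/e0; case: (excess x).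
  rewrite (bigD1 p) //= big1 // addn0 [\sum_x excess x ^ 2](bigD1 p) //= big1 ?addn0.
    by move=> E1; have -> : excess p = 2 by lia.
  by move=> x /e0' ->.
have pq : p != q by rewrite eq_sym.
have c2 : comps (~: [set p; q]) <= n.
  have [c [d [cd <-]]] := profile_del2 QH pq.
  by apply: comps_book_pair => //; rewrite n2.
(* Of 7 edges at most [1 + edge p q] survive on 4 vertices, leaving at least [3 - edge p q]
   components; the bound [c2] of 2 forces the edge. *)
exists p, q; have := comps_forest (~: [set p; q]); rewrite card_del2 //.
have := arcs_pair pq; rewrite sum_deg_H.
move: ep eq c2; rewrite /excess n2.
by case: (edge p q) => /=; lia.
Qed.

Lemma isomorphic_of_Q : isomorphic H (book n).
Proof.
have [a [b [ab cn]]] : exists a b, a != b /\ comps (~: [set a; b]) = n.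
  have [a [b [ab e]]] := @profile_del2 (book n) H (inl false) (inl true) (esym QH) isT.
  by exists a, b; rewrite e comps_book_spine.
suff [c [d [cd le]]] : exists c d : H, edge c d /\ n <= comps (~: [set c; d]).
  exact: (isomorphic_book cd).
have [e|e] := boolP (edge a b); first by exists a, b; rewrite cn.
exact/adjacent_n2/(nonadjacent_n2 ab).
Qed.

End Uniqueness.

Theorem theorem4p7 (n : nat) (hn : 0 < n) : Q_unique (book n).
Proof. by move=> H; apply: isomorphic_of_Q. Qed.
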